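(* Let $T$ be a rooted symmetric tree with daughter degree sequence $(k_1,k_2,\ldots)$, where $k_1=2$. Then $T$ has a weakly $\alpha$-labelling.
   Context: Graceful labelling: for a finite tree $T=(V,E)$, an injective function $f:V\to\{0,1,\ldots,|E|\}$ such that the induced edge labelling $g:E\to\{1,\ldots,|E|\}$, $g(uv)=|f(u)-f(v)|$, is also injective. Weakly $\alpha$-labelling: a graceful labelling $f$ of $T$ for which there is a positive integer $k$ such that for each edge $xy$ of $T$ either $f(x)\le k\le f(y)$ or $f(y)\le k\le f(x)$. Rooted symmetric tree: a finite rooted tree in which all vertices at the same level (distance from the root) have the same degree. Levels are numbered from $1$ to $q$, where level $1$ contains only the root and level $q$ is the last level. For $1\le i\le q$, $k_i$ is the common number of daughters (adjacent vertices at level $i+1$) of each vertex at level $i$; thus $k_i\ge 1$ for $i<q$ and $k_q=0$. The finite sequence $(k_1,\ldots,k_{q-1})$ is the daughter degree sequence of $T$. *)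

(* Defs.v *)
From mathcomp Require Import all_boot ssrint.

Set Implicit Arguments.
Unset Strict Implicit.
Unset Printing Implicit Defensive.

Section Trees.

Variables (V : finType) (e : rel V).

Definition simple_graph : Prop := symmetric e /\ irreflexive e.

(* A cycle is a [ucycle] with at least three vertices: in a simple graph the
   shorter ones are [::] and the back-and-forth walks [:: x; y]. *)
Definition acyclic : Prop := forall c : seq V, ucycle e c -> size c < 3.

Definition connected_graph : Prop := forall x y : V, connect e x y.

Definition tree : Prop := [/\ simple_graph, connected_graph & acyclic].

Definition edges : {set {set V}} :=
  [set A : {set V} | [exists x, exists y, e x y && (A == [set x; y])]].

Definition degree (x : V) : nat := #|[set y | e x y]|.

(* Number of edges of a shortest walk from x to y (#|V| if there is none). *)
Definition dist (x y : V) : nat :=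
  find (fun n => [exists p : n.-tuple V, path e x p && (last x p == y)])
       (iota 0 #|V|).

Definition level (r x : V) : nat := (dist r x).+1.

Definition num_levels (r : V) : nat := \max_(x : V) level r x.

Definition daughters (r x : V) : {set V} :=
  [set y | e x y & level r y == (level r x).+1].

Definition rooted_symmetric_tree (r : V) : Prop :=
  tree /\ forall x y : V, level r x = level r y -> degree x = degree y.

(* k = [:: k_1; ...; k_(q-1)] is indexed from 0, so k_i is nth 0 k i.-1;
   the default value 0 gives k_q = 0. *)
Definition daughter_degree_sequence (r : V) (k : seq nat) : Prop :=
  size k = (num_levels r).-1 /\
  forall x : V, #|daughters r x| = nth 0 k (level r x).-1.

(* `|f x - f y| is the absolute difference, not truncated subtraction.  That
   edge labels lie in {1, ..., #|edges|} follows from the first two clauses. *)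
Definition graceful_labelling (f : V -> nat) : Prop :=
  [/\ injective f,
      forall x : V, f x <= #|edges|
    & forall x y u v : V, e x y -> e u v ->
        `|f x - f y|%N = `|f u - f v|%N -> [set x; y] = [set u; v]].

Definition weakly_alpha_labelling (f : V -> nat) : Prop :=
  graceful_labelling f /\
  exists k : nat, 0 < k /\
    forall x y : V, e x y -> f x <= k <= f y \/ f y <= k <= f x.

End Trees.

(* Main.v *)
Require Import Defs.
From mathcomp Require Import all_boot ssralg ssrint.
From mathcomp Require Import zify.

Set Implicit Arguments.
Unset Strict Implicit.
Unset Printing Implicit Defensive.

(** Let a symmetric tree consist of a root and m copies, numbered 0, ..., m - 1,
    of a symmetric tree S on N vertices, and let g be a graceful labelling of S
    that gives the root of S the label 0.  Cut the labels 0, ..., mN - 1 into m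
    blocks of length N.  In copy i add iN to the labels g of the vertices at
    even depth in S, and (m - 1 - i)N to the labels at odd depth: each block
    then receives the even part of one copy and the odd part of the mirror
    copy, so no label is repeated.  An edge of S with g-difference d gets the
    label |(m - 1 - 2i)N +- d| in copy i, and the copies i and m - 1 - i
    together produce cN + d and cN - d for c = |m - 1 - 2i| (only d in the
    middle copy, where c = 0).  As c keeps the parity of m - 1 and 0 < d < N,
    these numbers are all different, and none is a multiple of N.
    The new root gets mN; the edge to the root of copy i, which has the label
    iN, gets (m - i)N.  So the labelling is graceful with the largest label at
    the root, and reversing it gives the root the label 0 that the next step of
    the induction requires.

    When m = 2, the two ends of an edge inside a copy lie in different blocks,
    one below N and the other at N or above; the root has the label 2N and its
    two daughters have the labels 0 and N.  So N separates the ends of every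
    edge.

    The induction is carried out on words instead of trees: a vertex is
    addressed by the sequence of child indices that leads to it from the root.
    The lemmas [label_inj], [gap_inj] and [label_alpha] are the argument above;
    [vertex_at_inj] and [vertex_at_onto] say that addresses coordinatize the
    tree, which is where connectedness and acyclicity enter. *)

(** * Labelling the words of child indices *)

Fixpoint tree_size (k : seq nat) : nat :=
  if k is m :: k' then (m * tree_size k').+1 else 1.

(** The words that lead to a vertex when the daughter degrees are k. *)
Fixpoint address (k w : seq nat) : bool :=
  match k, w with
  | _, [::] => true
  | m :: k', i :: w' => (i < m) && address k' w'
  | [::], _ :: _ => false
  end.

Fixpoint addresses (k : seq nat) : seq (seq nat) :=
  if k is m :: k' then
    [::] :: [seq i :: w | i <- iota 0 m, w <- addresses k']
  else [:: [::]].

(** The block that receives the vertex w of copy i out of m. *)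
Definition block (m i : nat) (w : seq nat) : nat :=
  if odd (size w) then m.-1 - i else i.

(** The label [l] of a vertex in the subtree enters as [N.-1 - l], because
    [label] puts the largest label at the root whereas the copies must have the
    label 0 at their roots. *)
Fixpoint label (k w : seq nat) : nat :=
  match k, w with
  | m :: k', i :: w' =>
      block m i w' * tree_size k' + ((tree_size k').-1 - label k' w')
  | _, _ => (tree_size k).-1
  end.

Lemma tree_size_gt0 k : 0 < tree_size k.
Proof. by case: k. Qed.

Lemma address_rcons k w c :
  address k (rcons w c) = address k w && (c < nth 0 k (size w)).
Proof.
elim: w k => [|i w IH] [|m k] //=.
  by case: k => [|? ?]; rewrite andbT.
by rewrite IH andbA.
Qed.

Lemma mem_addresses k w : (w \in addresses k) = address k w.
Proof.
elim: k w => [|m k IH] [|i w] //=; rewrite inE /=.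
rewrite -IH; apply/allpairsP/andP => [[[j v] /= [+ vP [-> ->]]]|[im wP]].
  by rewrite mem_iota.
by exists (i, w); rewrite mem_iota.
Qed.

Lemma size_addresses k : size (addresses k) = tree_size k.
Proof. by elim: k => //= m k IH; rewrite size_allpairs size_iota IH. Qed.

Lemma uniq_addresses k : uniq (addresses k).
Proof.
elim: k => //= m k IH; apply/andP; split.
  by apply/allpairsP => -[[]] ? ? [].
apply: allpairs_uniq => //; first exact: iota_uniq.
by move=> [i w] [j v] _ _ /= [-> ->].
Qed.

Lemma block_lt m i w : i < m -> block m i w < m.
Proof. by rewrite /block; case: ifP => _; lia. Qed.

Lemma block_rcons m i w c : i < m -> block m i (rcons w c) = m.-1 - block m i w.
Proof. by rewrite /block size_rcons /=; case: (odd _) => //=; lia. Qed.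

Lemma block_inj m i j w : i < m -> j < m -> block m i w = block m j w -> i = j.
Proof. by rewrite /block; case: ifP => _; lia. Qed.

Lemma label_root k : label k [::] = (tree_size k).-1.
Proof. by case: k. Qed.

Lemma label_lt k w : address k w -> label k w < tree_size k.
Proof.
elim: k w => [|m k IH] [|i w] //= /andP[im wP].
have := block_lt w im; have := tree_size_gt0 k; have := IH _ wP.
move: (label _ _) (tree_size _) (block _ _ _) => l N b; nia.
Qed.

Lemma digits_inj N a a' g g' :
  g < N -> g' < N -> a * N + g = a' * N + g' -> a = a' /\ g = g'.
Proof.
move=> gN g'N E.
have N0 : 0 < N by apply: leq_trans gN.
have: (a * N + g) %/ N = (a' * N + g') %/ N by rewrite E.
rewrite !divnMDl // !divn_small // !addn0 => aa'; split=> //.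
by move: E; rewrite aa' => /addnI.
Qed.

(** The block and the position within it are the quotient and the remainder
    of the label by the size of the subtree; the position determines the vertex
    of the subtree, hence its parity, and then the block determines the copy. *)
Lemma label_inj k w w' :
  address k w -> address k w' -> label k w = label k w' -> w = w'.
Proof.
elim: k w w' => [|m k IH] [|i w] [|i' w'] //=.
- move=> _ /andP[im wP]; have := block_lt w' im; have := tree_size_gt0 k.
  move: (label _ _) (tree_size _) (block _ _ _) => l N b; nia.
- move=> /andP[im wP] _; have := block_lt w im; have := tree_size_gt0 k.
  move: (label _ _) (tree_size _) (block _ _ _) => l N b; nia.
move=> /andP[im wP] /andP[i'm w'P].
have lN := label_lt wP; have l'N := label_lt w'P.
move=> /digits_inj[]; [lia|lia|move=> bb' gg'].
have ww' : w = w' by apply: IH => //; lia.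
by move: bb'; rewrite ww' => /block_inj->.
Qed.

(** The induced label of the edge from the vertex w to its c-th daughter. *)
Definition gap (k w : seq nat) (c : nat) : nat :=
  `|label k w - label k (rcons w c)|%N.

Lemma gap_root m k c : c < m -> gap (m :: k) [::] c = (m - c) * tree_size k.
Proof.
move=> cm; rewrite /gap /= label_root subnn addn0 /block /=.
by rewrite mulnBl; nia.
Qed.

Lemma gap_cons m k i w c : i < m -> address k (rcons w c) ->
  gap (m :: k) (i :: w) c =
  `|(block m i w * tree_size k + label k (rcons w c)) -
    ((m.-1 - block m i w) * tree_size k + label k w)|%N.
Proof.
move=> im wcP; rewrite /gap /= block_rcons //.
have := label_lt wcP; move: wcP; rewrite address_rcons => /andP[/label_lt]; lia.
Qed.

Lemma gap_neq0 k w c : address k (rcons w c) -> 0 < gap k w c.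
Proof.
move=> wcP; have wP : address k w.
  by move: wcP; rewrite address_rcons => /andP[].
suff: label k w <> label k (rcons w c) by rewrite /gap; lia.
by move=> /(label_inj wP wcP)/(congr1 size); rewrite size_rcons; lia.
Qed.

Lemma small_multiple (z t : int) (N : nat) :
  (z * N = t)%R -> `|t|%N < N -> z = 0%R.
Proof. by move=> <-; rewrite abszM; case: z => [[|z]|z] //=; nia. Qed.

(** The edges inside the copies avoid the multiples of [tree_size k], which are
    exactly the labels of the edges at the root. *)
Lemma gap_cons_mod m k i w c q : i < m -> address k (rcons w c) ->
  gap (m :: k) (i :: w) c <> q * tree_size k.
Proof.
move=> im wcP; rewrite gap_cons //.
have := gap_neq0 wcP; have := label_lt wcP; rewrite /gap.
move: wcP; rewrite address_rcons => /andP[/label_lt + _].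
move: (label _ _) (label _ _) (tree_size _) (block _ _ _) => g h N b hN gN gh E.
move: {m im}(m.-1 - b) E => b' E.
have [E1|E1] : ((b%:Z - b'%:Z - q%:Z) * N = h%:Z - g%:Z \/
                (b%:Z - b'%:Z + q%:Z) * N = h%:Z - g%:Z)%R by lia.
- by have E2 := small_multiple E1; move: E1; rewrite E2; lia.
- by have E2 := small_multiple E1; move: E1; rewrite E2; lia.
Qed.

(** Two equal absolute values give equal or opposite differences.  On both
    sides the blocks of the two ends add up to m - 1, so the multiples of N in
    the two differences differ by an even multiple of N.  This is balanced by
    the terms from the positions, which are smaller than 2N in absolute value
    together, so it is 0. *)
Lemma gap_cons_inj m N b b' g h g' h' : b < m -> b' < m ->
    g < N -> h < N -> g' < N -> h' < N ->
    `|(b * N + g) - ((m.-1 - b) * N + h)|%N =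
    `|(b' * N + g') - ((m.-1 - b') * N + h')|%N ->
  b = b' /\ (g%:Z - h%:Z = g'%:Z - h'%:Z)%R \/
  (g%:Z - h%:Z = h'%:Z - g'%:Z)%R.
Proof.
move=> bm b'm gN hN g'N h'N E.
have [E1|E1] : ((b%:Z - b'%:Z) * (2 * N)%N = (g'%:Z - h'%:Z) - (g%:Z - h%:Z) \/
   (b%:Z - (m.-1 - b')%:Z) * (2 * N)%N = - (g%:Z - h%:Z) - (g'%:Z - h'%:Z))%R.
- have : (m.-1 - b) + b = (m.-1 - b') + b' by lia.
  move: (m.-1 - b) (m.-1 - b') E => d d' E D.
  have : d * N + b * N = d' * N + b' * N by rewrite -!mulnDl D.
  lia.
- have E2 := small_multiple E1; left; split; first by lia.
  by move: E1; rewrite E2; lia.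
- have E2 := small_multiple E1; right.
  by move: E1; rewrite E2; lia.
Qed.

(** Equal gaps inside the copies reduce, by [gap_cons_inj], to equal gaps in the
    subtree, so by induction to the same edge of the subtree.  In the case of
    opposite differences this edge would have gap 0. *)
Lemma gap_inj k w w' c c' :
    address k (rcons w c) -> address k (rcons w' c') ->
  gap k w c = gap k w' c' -> rcons w c = rcons w' c'.
Proof.
elim: k w w' c c' => [|m k IH] [|i w] [|i' w'] c c' //=.
- move=> /andP[cm _] /andP[c'm _]; rewrite !gap_root //.
  move/eqP; rewrite eqn_pmul2r ?tree_size_gt0 // => /eqP E.
  by congr [:: _]; lia.
- move=> /andP[cm _] /andP[i'm w'P]; rewrite gap_root //.
  by move/esym/(gap_cons_mod i'm w'P).
- move=> /andP[im wP] /andP[c'm _]; rewrite (gap_root k c'm).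
  by move/(gap_cons_mod im wP).
move=> /andP[im wP] /andP[i'm w'P]; rewrite !gap_cons //.
have lt v d : address k (rcons v d) -> label k v < tree_size k.
  by rewrite address_rcons => /andP[/label_lt].
case/(gap_cons_inj (block_lt w im) (block_lt w' i'm) (label_lt wP) (lt _ _ wP)
   (label_lt w'P) (lt _ _ w'P)) => [[bb' E]|E].
  (* The same edge of the subtree, in copies with the same block: same copy. *)
  have ww' : rcons w c = rcons w' c' by apply: IH => //; rewrite /gap; lia.
  have [ww _] := rcons_inj ww'.
  by move: bb'; rewrite ww' ww => /block_inj->.
have ww' : rcons w c = rcons w' c' by apply: IH => //; rewrite /gap; lia.
have [ww _] := rcons_inj ww'; have := gap_neq0 wP.
by move: E; rewrite /gap ww' ww; lia.
Qed.

Lemma label_alpha k w c : address (2 :: k) (rcons w c) ->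
  label (2 :: k) w <= tree_size k <= label (2 :: k) (rcons w c) \/
  label (2 :: k) (rcons w c) <= tree_size k <= label (2 :: k) w.
Proof.
case: w => [|i w] /=.
  by case: c => [|[|c]] //; rewrite /block /= label_root; lia.
move=> /andP[i2 wcP]; rewrite block_rcons //.
move: wcP; rewrite address_rcons => /andP[/label_lt + _].
case: (block 2 i w) (block_lt w i2) => [|[|b]] //= _; lia.
Qed.

(** * Distances and parents in a tree *)

Lemma dist_le (V : finType) (e : rel V) x p :
  path e x p -> dist e x (last x p) <= size p.
Proof.
move=> xp; rewrite /dist; set a := (X in find X _).
case: (leqP (find a (iota 0 #|V|)) (size p)) => // lt.
have pV : size p < #|V|.
  by apply: leq_trans lt _; rewrite -[X in _ <= X](size_iota 0) find_size.
have := before_find 0 lt; rewrite nth_iota // /a => /existsP[].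
by exists (in_tuple p); rewrite xp eqxx.
Qed.

Lemma dist_path (V : finType) (e : rel V) x y : connect e x y ->
  exists p, [/\ path e x p, last x p = y & size p = dist e x y].
Proof.
case/connectP => p0 /shortenP[p xp up _] ->.
rewrite /dist; set a := (X in find X _).
have pV : size p < #|V|.
  by have := max_card (mem (x :: p)); rewrite (card_uniqP up).
have ha : has a (iota 0 #|V|).
  apply/hasP; exists (size p); first by rewrite mem_iota.
  by apply/existsP; exists (in_tuple p); rewrite xp eqxx.
have := nth_find 0 ha; rewrite nth_iota; last first.
  by rewrite -[X in _ < X](size_iota 0) -has_find.
by case/existsP => q /andP[xq /eqP lq]; exists q; rewrite size_tuple.
Qed.

Section Graph.

Variables (V : finType) (e : rel V) (r : V).
Hypothesis treeP : tree e.

Lemma tree_sym : symmetric e. Proof. by case: treeP => -[]. Qed.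

Lemma dist_root : dist e r r = 0.
Proof. by apply/eqP; rewrite -leqn0; apply: (@dist_le _ e r [::]). Qed.

Lemma dist_edge x y : e x y -> dist e r y <= (dist e r x).+1.
Proof.
case: treeP => _ /(_ r x) /dist_path[p [rp <- <-]] _ xy.
have := @dist_le _ e r (rcons p y); rewrite last_rcons size_rcons; apply.
by rewrite rcons_path rp.
Qed.

Lemma dist_eq0 x : dist e r x = 0 -> x = r.
Proof.
by case: treeP => _ /(_ r x) /dist_path[p [_ <- <-]] _; case: p.
Qed.

Lemma dist_parent x n : dist e r x = n.+1 -> exists2 y, e y x & dist e r y = n.
Proof.
move=> dx; case: treeP => _ /(_ r x) /dist_path[p [+ + +]] _.
rewrite dx; case/lastP: p => // p z; rewrite rcons_path last_rcons size_rcons.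
move=> /andP[rp pz] zx [pn]; exists (last r p); first by rewrite -zx.
by have := dist_le rp; have := dist_edge pz; rewrite zx dx pn; lia.
Qed.

(** The tree is recovered from distances as the graph of the edges between
    consecutive levels.  Restricting to these edges, at depth at most n, makes
    it possible to close cycles in a controlled way: the excluded vertices and
    edges are available as the closing step. *)
Let below n : rel V := fun u v =>
  [&& e u v, dist e r u <= n, dist e r v <= n & dist e r u != dist e r v].

Lemma connect_below n x : dist e r x <= n -> connect (below n) x r.
Proof.
move: {-1}(dist e r x) (erefl (dist e r x)) => d; elim: d x => [|d IH] x dx dn.
  by rewrite (dist_eq0 dx).
have [y yx dy] := dist_parent dx.
apply: connect_trans (IH _ dy (ltnW dn)); apply: connect1.
by rewrite /below tree_sym yx dx dy dn ltnW //= gtn_eqF.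
Qed.

(** Both vertices descend to the root, so they are joined by a path that uses
    no edge within a level and does not go beyond level n; in particular it is
    not a single edge. *)
Lemma below_path n x y : dist e r x = n -> dist e r y = n -> x != y ->
  exists p, [/\ path e x p, last x p = y, uniq (x :: p), 1 < size p
               & forall z, z \in x :: p -> dist e r z <= n].
Proof.
move=> dx dy xy.
have sb : connect_sym (below n).
  apply: sym_connect_sym => u v; rewrite /below tree_sym eq_sym.
  by rewrite [(dist e r u <= n) && _]andbCA.
have: connect (below n) x y.
  apply: connect_trans (connect_below _) _; rewrite ?dx //.
  by rewrite sb connect_below ?dy.
case/connectP => p0 /shortenP[p xp up _] yl; exists p.
have ep : path e x p by apply: sub_path xp => u v /and4P[].
split=> //.
  case: p xp yl {up ep} => [_ /= yx|z [|//] /=]; first by rewrite yx eqxx in xy.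
  by case/andP => /and4P[_ _ _ +] _ yz; rewrite -yz dx dy eqxx.
have: all (fun z => dist e r z <= n) p.
  elim: p x xp {dx up ep yl xy} => //= z p IH x /andP[/and4P[_ _ zn _] zp].
  by rewrite zn (IH z).
by move=> /allP pn z; rewrite inE => /orP[/eqP->|/pn//]; rewrite dx.
Qed.

(** An edge within a level would close the path of [below_path] to a cycle. *)
Lemma edge_dist_neq x y : e x y -> dist e r x <> dist e r y.
Proof.
move=> exy dxy; have xy : x != y.
  by apply: contraTneq exy => ->; case: treeP => -[_ ->].
have [p [xp py up p1 _]] := below_path dxy erefl xy.
have uc : ucycle e (x :: p).
  by rewrite /ucycle up /= rcons_path xp py tree_sym exy.
by case: treeP => _ _ /(_ _ uc) /=; lia.
Qed.

(** A vertex with two parents would close the path of [below_path] between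
    them to a cycle, since the vertex itself lies deeper than this path. *)
Lemma parent_unique x y z : e x z -> e y z ->
  dist e r z = (dist e r x).+1 -> dist e r z = (dist e r y).+1 -> x = y.
Proof.
move=> xz yz dx dy; apply/eqP; apply: contraT => xy.
have [] := below_path _ erefl xy; first by apply: succn_inj; rewrite -dx dy.
move=> p [xp py up p1 pn].
have zp : z \notin x :: p by apply/negP => /pn; rewrite dy ltnn.
have uc : ucycle e (z :: x :: p).
  by rewrite /ucycle cons_uniq zp up /= tree_sym xz rcons_path xp py yz.
by case: treeP => _ _ /(_ _ uc) /=; lia.
Qed.

Lemma daughtersE x y :
  (y \in daughters e r x) = e x y && (dist e r y == (dist e r x).+1).
Proof. by rewrite inE /level eqSS. Qed.

Lemma edge_daughters x y :
  e x y -> y \in daughters e r x \/ x \in daughters e r y.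
Proof.
move=> xy; have yx := xy; rewrite tree_sym in yx; rewrite !daughtersE xy yx /=.
have := dist_edge xy; have := dist_edge yx; have := edge_dist_neq xy; lia.
Qed.

(** Each vertex other than the root is charged to the edge to its parent. *)
Lemma card_edges_ge : #|V|.-1 <= #|edges e|.
Proof.
pose parent x := odflt x [pick y | e y x && (dist e r x == (dist e r y).+1)].
have parentP x : x != r ->
    e (parent x) x /\ dist e r x = (dist e r (parent x)).+1.
  move=> xr; rewrite /parent; case: pickP => [y /andP[? /eqP]|nP] //=.
  case dx: (dist e r x) => [|n]; first by rewrite (dist_eq0 dx) eqxx in xr.
  by have [y yx dy] := dist_parent dx; have := nP y; rewrite yx dx dy eqxx.
have inj : {in predC1 r &, injective (fun x => [set x; parent x])}.
  move=> x y xr yr E; have [_ dx] := parentP _ xr; have [_ dy] := parentP _ yr.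
  have: x \in [set y; parent y] by rewrite -E set21.
  rewrite !inE => /orP[/eqP //|/eqP xy].
  have: y \in [set x; parent x] by rewrite E set21.
  rewrite !inE => /orP[/eqP //|/eqP yx].
  by move: dx dy; rewrite -yx -xy; lia.
rewrite -(cardC1 r) -(card_in_imset inj) subset_leq_card //.
apply/subsetP => _ /imsetP[x /parentP[px _] ->].
rewrite inE; apply/existsP; exists x; apply/existsP; exists (parent x).
by rewrite tree_sym px eqxx.
Qed.

(** * Addresses of the vertices *)

Variable k : seq nat.
Hypothesis daughtersP : forall x, #|daughters e r x| = nth 0 k (dist e r x).

(** The default [x] of [nth] is reached only by words that are not addresses. *)
Definition vertex_at (w : seq nat) : V :=
  foldl (fun x c => nth x (enum (daughters e r x)) c) r w.

Lemma vertex_at_rcons w c :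
  vertex_at (rcons w c) =
  nth (vertex_at w) (enum (daughters e r (vertex_at w))) c.
Proof. by rewrite /vertex_at foldl_rcons. Qed.

Lemma vertex_at_daughter w c : c < #|daughters e r (vertex_at w)| ->
  vertex_at (rcons w c) \in daughters e r (vertex_at w).
Proof. by move=> cw; rewrite vertex_at_rcons -mem_enum mem_nth // -cardE. Qed.

Lemma dist_vertex_at w : address k w -> dist e r (vertex_at w) = size w.
Proof.
elim/last_ind: w => [_|w c IH]; first exact: dist_root.
rewrite address_rcons => /andP[/IH dw cw].
have := @vertex_at_daughter w c; rewrite daughtersP dw => /(_ cw).
by rewrite daughtersE size_rcons dw => /andP[_ /eqP].
Qed.

Lemma address_daughter w c : address k (rcons w c) ->
  vertex_at (rcons w c) \in daughters e r (vertex_at w).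
Proof.
rewrite address_rcons => /andP[/dist_vertex_at dw cw].
by apply: vertex_at_daughter; rewrite daughtersP dw.
Qed.

(** The last letters are removed one at a time: the parents of the common
    vertex agree by [parent_unique], and the letters are positions in the
    duplicate-free enumeration of the daughters. *)
Lemma vertex_at_inj w w' : address k w -> address k w' ->
  vertex_at w = vertex_at w' -> w = w'.
Proof.
elim/last_ind: w w' => [|w c IH] w' wP w'P E.
  by move: (congr1 (dist e r) E); rewrite !dist_vertex_at //; case: (w').
case/lastP: w' w'P E => [|w' c'] w'P E.
  by move: (congr1 (dist e r) E); rewrite !dist_vertex_at // size_rcons.
have := address_daughter wP; have := address_daughter w'P.
rewrite -E !daughtersE => /andP[xz' /eqP dx'] /andP[xz /eqP dx].
have ww := parent_unique xz xz' dx dx'.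
move: wP w'P; rewrite !address_rcons => /andP[wP cw] /andP[w'P cw'].
have ww' : w = w' by apply: IH.
move: cw cw' E; rewrite -ww' !vertex_at_rcons => cw cw' /eqP.
rewrite nth_uniq ?enum_uniq -?cardE ?daughtersP ?dist_vertex_at //.
by move=> /eqP->.
Qed.

Lemma daughter_vertex_at w y : address k w ->
  y \in daughters e r (vertex_at w) ->
  exists2 c, address k (rcons w c) & vertex_at (rcons w c) = y.
Proof.
move=> wP yw; set s := enum (daughters e r (vertex_at w)).
have ys : y \in s by rewrite mem_enum.
exists (index y s); last by rewrite vertex_at_rcons nth_index.
by rewrite address_rcons wP -(dist_vertex_at wP) -daughtersP cardE index_mem.
Qed.

Lemma vertex_at_onto x : exists2 w, address k w & vertex_at w = x.
Proof.
move: {1}(dist e r x) (erefl (dist e r x)) => d; elim: d x => [|d IH] x dx.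
  by exists [::]; [case: (k) | rewrite (dist_eq0 (esym dx))].
have [y yx dy] := dist_parent (esym dx).
have [w wP wy] := IH y (esym dy).
have [|c cP cx] := @daughter_vertex_at w x wP; last by exists (rcons w c).
by rewrite daughtersE wy yx dy -dx eqxx.
Qed.

Lemma tree_size_le_card : tree_size k <= #|V|.
Proof.
have u : uniq (map vertex_at (addresses k)).
  rewrite map_inj_in_uniq ?uniq_addresses // => w w'; rewrite !mem_addresses.
  exact: vertex_at_inj.
by rewrite -size_addresses -(size_map vertex_at) -(card_uniqP u) max_card.
Qed.

End Graph.

Theorem lemma1 (V : finType) (e : rel V) (r : V) (k : seq nat)
  (hT : rooted_symmetric_tree e r)
  (hk : daughter_degree_sequence e r k)
  (hk1 : nth 0 k 0 = 2) :
  exists f : V -> nat, weakly_alpha_labelling e f.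
Proof.
case: hT => treeP _; case: hk => _ daughtersP.
have addrP x : exists w, address k w /\ vertex_at e r w = x.
  by have [w] := vertex_at_onto treeP daughtersP x; exists w.
have {addrP}[addr addrP] := fin_all_exists addrP.
have addr_valid x := (addrP x).1; have addrK x := (addrP x).2.
have addr_inj x y : addr x = addr y -> x = y.
  by move=> E; rewrite -(addrK x) E addrK.
have addr_daughter x y :
    y \in daughters e r x -> exists c, addr y = rcons (addr x) c.
  rewrite -{1}(addrK x).
  case/(daughter_vertex_at daughtersP (addr_valid x)) => c cP cy.
  by exists c; apply: (vertex_at_inj treeP daughtersP) => //; rewrite addrK.
have edge_gap x y : e x y -> exists w c,
    [/\ address k (rcons w c),
        `|label k (addr x) - label k (addr y)|%N = gap k w c
      & [set x; y] = [set vertex_at e r w; vertex_at e r (rcons w c)]].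
  case/(edge_daughters r treeP)=> /addr_daughter[c E];
    [exists (addr x)|exists (addr y)]; exists c; rewrite -E !addrK;
    split=> //; last exact: setUC.
    by rewrite /gap E.
  by rewrite /gap E distnC.
exists (fun x => label k (addr x)); split; first split.
- by move=> x y /label_inj E; apply/addr_inj/E.
(* The labels are below the number of addresses, which is at most #|V|. *)
- move=> x; have := label_lt (addr_valid x); have := card_edges_ge r treeP.
  have := tree_size_le_card treeP daughtersP; lia.
- move=> x y u v /edge_gap[w [c [wP -> ->]]] /edge_gap[w' [c' [w'P -> ->]]].
  by move=> /(gap_inj wP w'P) E; rewrite E; have [-> _] := rcons_inj E.
have [k' kE] : exists k', k = 2 :: k'.
  by case: (k) (hk1) => [|m k'] //= ->; exists k'.
exists (tree_size k'); split; first exact: tree_size_gt0.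
move=> x y /(edge_daughters r treeP)[] /addr_daughter[c E]; rewrite E kE.
  by apply: label_alpha; rewrite -E -kE.
by apply/or_comm/label_alpha; rewrite -E -kE.
Qed.
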